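(* Let $\varepsilon>0$. The group of isometries of the discrete Urysohn metric space $\mathbb U^{\varepsilon\mathbb Z}$ does not have the fixed point on compacta property.
   Context: $\mathbb U^{\varepsilon\mathbb Z}$ denotes the complete separable Urysohn space for the class of metric spaces whose metrics take values only in the lattice $\varepsilon\mathbb Z$: it is the complete separable metric space, unique up to isometry, with metric taking values in $\varepsilon\mathbb Z$, such that whenever $A$ is a finite subspace and $A'=A\cup\{a\}$ is a one-point metric space extension of $A$ whose metric takes values in $\varepsilon\mathbb Z$, the embedding $A\hookrightarrow\mathbb U^{\varepsilon\mathbb Z}$ extends to an isometric embedding $A'\hookrightarrow\mathbb U^{\varepsilon\mathbb Z}$. The isometry group (all isometries onto itself) carries the topology of pointwise convergence with respect to the metric of the space. A topological group has the fixed point on compacta property if every continuous action of it on a (nonempty) compact space has a fixed point. *)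

(* Defs.v *)
From HB Require Import structures.
From mathcomp Require Import all_boot all_order all_algebra.
From mathcomp Require Import all_classical all_reals all_analysis.

Set Implicit Arguments.
Unset Strict Implicit.
Unset Printing Implicit Defensive.

Import Order.TTheory GRing.Theory Num.Theory metricType_numDomainType.

Local Open Scope classical_set_scope.
Local Open Scope ring_scope.

(* Multiplicative counterpart of MathComp-Analysis's topologicalZmodType. *)
HB.mixin Record Topological_isTopologicalGroup G
    & Topological G & Group G := {
  mulg_continuous : continuous (fun gh : G * G => (gh.1 * gh.2)%g) ;
  invg_continuous : continuous (fun g : G => g^-1%g)
}.

#[short(type="topologicalGroupType")]
HB.structure Definition TopologicalGroup :=
  {G of Topological G & Group G & Topological_isTopologicalGroup G}.

Definition continuous_action (G : topologicalGroupType) (X : topologicalType)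
    (act : G -> X -> X) : Prop :=
  [/\ forall x, act 1%g x = x,
      forall g h x, act (g * h)%g x = act g (act h x)
    & continuous (fun gx : G * X => act gx.1 gx.2)].

(* Compact spaces are Hausdorff. This matters: otherwise every nontrivial group
   would act without fixed points on itself with the indiscrete topology. *)
Definition fixed_point_on_compacta (G : topologicalGroupType) : Prop :=
  forall X : topologicalType,
    [set: X] !=set0 -> compact [set: X] -> hausdorff_space X ->
  forall act : G -> X -> X, continuous_action act ->
  exists x : X, forall g : G, act g x = x.

Section Urysohn.
Variables (R : realType) (eps : R).

Definition lattice_valued (X : metricType R) : Prop :=
  forall x y : X, exists k : int, mdist x y = eps *~ k.

Definition isometric_on (X Y : metricType R) (A : set X) (f : X -> Y) : Prop :=
  forall x y, A x -> A y -> mdist (f x) (f y) = mdist x y.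

(* The embedding i of A in X is a total function on U, but only its values on A
   matter. The case of empty A makes U nonempty. *)
Definition one_point_extension_property (U : metricType R) : Prop :=
  forall (A : set U) (X : metricType R) (i : U -> X) (a : X),
    finite_set A -> lattice_valued X -> isometric_on A i ->
    [set: X] = a |` (i @` A) ->
  exists2 k : X -> U, isometric_on [set: X] k & forall x, A x -> k (i x) = x.

(* completeType is not used since it requires a pointed space. *)
Definition complete_space (U : metricType R) : Prop :=
  forall F : set_system U, ProperFilter F -> cauchy F -> exists x : U, F --> x.

Definition separable_space (U : metricType R) : Prop :=
  exists2 D : set U, countable D & dense D.

Definition lattice_urysohn (U : metricType R) : Prop :=
  [/\ complete_space U, separable_space U, lattice_valued U
    & one_point_extension_property U].

End Urysohn.

Section Isometry.
Variables (R : realType) (U : metricType R).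

Record self_isometry := Isometry {
  isometry_fun :> U -> U ;
  mdist_isometry : forall x y,
    mdist (isometry_fun x) (isometry_fun y) = mdist x y ;
  isometry_surj : forall y, exists x, isometry_fun x = y
}.

Lemma isometry_ext (f g : self_isometry) : (forall x, f x = g x) -> f = g.
Proof.
case: f g => f fd fs [g gd gs] /= /funext fg; case: _ / fg gd gs => gd gs.
by congr Isometry; exact: Prop_irrelevance.
Qed.

Lemma isometry_inj (f : self_isometry) x y : f x = f y -> x = y.
Proof.
move=> fxy; apply: mdist_positivity.
by rewrite -(mdist_isometry f) fxy mdistxx.
Qed.

HB.instance Definition _ := gen_eqMixin self_isometry.
HB.instance Definition _ := gen_choiceMixin self_isometry.

Definition isometry_one : self_isometry :=
  @Isometry id (fun _ _ => erefl) (fun y => ex_intro _ y erefl).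

Section Composition.
Variables f g : self_isometry.

Let comp_dist x y : mdist (f (g x)) (f (g y)) = mdist x y.
Proof. by rewrite !mdist_isometry. Qed.

Let comp_surj z : exists x, f (g x) = z.
Proof.
have [y <-] := isometry_surj f z; have [x <-] := isometry_surj g y.
by exists x.
Qed.

Definition isometry_mul : self_isometry := @Isometry (f \o g) comp_dist comp_surj.
End Composition.

Section Inverse.
Variable f : self_isometry.

Let inv_fun y : U := sval (cid (isometry_surj f y)).

Let inv_funK y : f (inv_fun y) = y.
Proof. exact: svalP (cid (isometry_surj f y)). Qed.

Let inv_dist x y : mdist (inv_fun x) (inv_fun y) = mdist x y.
Proof. by rewrite -(mdist_isometry f) !inv_funK. Qed.

Let inv_surj y : exists x, inv_fun x = y.
Proof. by exists (f y); apply: (@isometry_inj f); rewrite inv_funK. Qed.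

Definition isometry_inv : self_isometry := Isometry inv_dist inv_surj.

Lemma isometry_invK y : f (isometry_inv y) = y.
Proof. exact: inv_funK. Qed.
End Inverse.

Let mulA : associative isometry_mul.
Proof. by move=> f g h; exact: isometry_ext. Qed.

Let mul1 : left_id isometry_one isometry_mul.
Proof. by move=> f; exact: isometry_ext. Qed.

Let mulr1 : right_id isometry_one isometry_mul.
Proof. by move=> f; exact: isometry_ext. Qed.

Let mulV : left_inverse isometry_one isometry_inv isometry_mul.
Proof.
move=> f; apply: isometry_ext => x /=.
by apply: (@isometry_inj f); rewrite isometry_invK.
Qed.

Let mulrV : right_inverse isometry_one isometry_inv isometry_mul.
Proof. by move=> f; apply: isometry_ext => x; exact: isometry_invK. Qed.

HB.instance Definition _ :=
  isGroup.Build self_isometry mulA mul1 mulr1 mulV mulrV.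

Lemma isometry_mulE (f g : self_isometry) x : (f * g)%g x = f (g x).
Proof. by []. Qed.

Lemma isometry_invgK (f : self_isometry) y : f ((f^-1)%g y) = y.
Proof. exact: isometry_invK. Qed.

HB.instance Definition _ := Topological.copy self_isometry
  (initial_topology (fun f : self_isometry => (f : {ptws U -> U}))).

Lemma cvg_isometryP (T : Type) (F : set_system T) (FF : Filter F)
    (f : T -> self_isometry) (g : self_isometry) :
  f @ F --> g <-> forall x : U, (fun t => f t x) @ F --> g x.
Proof.
split=> [fg x|fg].
  have ctx : continuous (fun f : self_isometry => (f : {ptws U -> U})).
    exact: initial_continuous.
  have := cvg_comp f _ fg (ctx g).
  by move=> /pointwise_cvgP; exact.
have : {ptws, ((fun t => f t : U -> U) @ F) --> (g : U -> U)}.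
  by apply/pointwise_cvgP.
move=> fgp A [B [[C Cop <-] Cg CA]].
apply: filterS CA _; apply: fgp.
by apply: open_nbhs_nbhs; split.
Qed.

Let mul_cts : continuous (fun gh : self_isometry * self_isometry => (gh.1 * gh.2)%g).
Proof.
move=> [g h]; apply/cvg_isometryP => x /=.
have /cvg_isometryP gP : fst p @[p --> (g, h)] --> g by exact: cvg_fst.
have /cvg_isometryP hP : snd p @[p --> (g, h)] --> h by exact: cvg_snd.
apply/cvgrPdist_lt => e e0; near=> p.
rewrite (le_lt_trans (metric_triangle _ (p.1 (h x)) _))//.
rewrite (splitr e) ltrD ?mdist_isometry//.
- near: p; apply: cvgr_dist_lt; [exact: gP|exact: divr_gt0].
- near: p; apply: cvgr_dist_lt; [exact: hP|exact: divr_gt0].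
Unshelve. all: by end_near. Qed.

Let inv_cts : continuous (fun g : self_isometry => g^-1%g).
Proof.
move=> g; apply: (cvg_isometryP (nbhs_filter g) _ _).2 => x.
have gP : forall x, (fun h : self_isometry => h x) @ g --> g x.
  by apply: (cvg_isometryP (nbhs_filter g) id g).1; exact: cvg_id.
apply/cvgrPdist_lt => e e0; near=> h.
rewrite -(mdist_isometry h) isometry_invgK metric_sym -{1}(isometry_invgK g x).
by near: h; apply: cvgr_dist_lt; [exact: gP|].
Unshelve. all: by end_near. Qed.

HB.instance Definition _ :=
  Topological_isTopologicalGroup.Build self_isometry mul_cts inv_cts.

End Isometry.

(* Main.v *)
Require Import Defs.
From HB Require Import structures.
From mathcomp Require Import all_boot all_order all_algebra.
From mathcomp Require Import all_classical all_reals all_analysis.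

(** The idea is that a linear order on a set, or just a tournament (a choice of
    one orientation of each pair of distinct points), cannot be invariant under
    a map that swaps two points, while tournaments form a compact space.

    In detail, the tournaments on [D] are a closed subset of the Cantor cube
    [{ptws D * D -> bool}], hence a compact Hausdorff space
    ([tournament_compact]).  It is nonempty, since a choice function picks one
    point of each pair ([tournament_exists]).  A group acting on [D] acts on
    tournaments by transport, and this action is continuous as soon as the
    stabilizers of points of [D] are open ([tournament_push_action]).  A fixed
    point is an invariant tournament, which is impossible if some element of the
    group swaps two distinct points ([swap_no_fixed_point]).

    It remains to see that the isometry group of the Urysohn space satisfies
    these hypotheses.  Distances in [eps * Z] make the space uniformly discrete
    ([lattice_dist_eq]), so pointwise convergence is eventual equality at each
    point and stabilizers are open.  A separable discrete space is countable
    ([urysohn_countable]); hence the one-point extension property gives, by back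
    and forth, that every finite partial isometry extends to an isometry of the
    space onto itself ([ultrahomogeneous]).  The swap of two points is a finite
    partial isometry, and two distinct points exist
    ([urysohn_two_points]). *)

Set Implicit Arguments.
Unset Strict Implicit.
Unset Printing Implicit Defensive.

Import Order.TTheory GRing.Theory Num.Theory metricType_numDomainType.

Local Open Scope classical_set_scope.
Local Open Scope ring_scope.

(** * Subspaces *)

Lemma compact_set_type (X : topologicalType) (A : set X) :
  compact A -> compact [set: A].
Proof.
move=> Aco F FF _.
have FA : (set_val @ F) A.
  by apply: nearW => z; exact: set_valP.
have [x [Ax clx]] := Aco (set_val @ F) (fmap_proper_filter _ _) FA.
exists (exist _ x (mem_set Ax)); split=> // P Q FP.
case=> _ [[V Vop <-] Vx VQ].
have FvP : F (set_val @^-1` (set_val @` P)).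
  exact: filterS (@preimage_image _ _ set_val P) FP.
have [_ [[z Pz <-] Vz]] := clx _ V FvP (open_nbhs_nbhs (conj Vop Vx)).
by exists z; split=> //; exact: VQ.
Qed.

Lemma hausdorff_set_type (X : topologicalType) (A : set X) :
  hausdorff_space X -> hausdorff_space A.
Proof.
move=> hX p q pq; apply/val_inj/hX => P Q nP nQ.
have cval : continuous (set_val : A -> X) by exact: initial_continuous.
have [z [Pz Qz]] := pq _ _ (cval p P nP) (cval q Q nQ).
by exists (set_val z).
Qed.

Section SubspaceMetric.
Variables (R : realType) (M : metricType R) (A : set M).

Let sub_dist (x y : A) : R := mdist (set_val x) (set_val y).

Let sub_dist_ge0 x y : 0 <= sub_dist x y.
Proof. exact: mdist_ge0. Qed.

Let sub_dist_positivity x y : sub_dist x y = 0 -> x = y.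
Proof. by move=> /mdist_positivity; exact: val_inj. Qed.

Let ball_sub_dist (x : A) d : ball x d = [set y | sub_dist x y < d].
Proof. by rewrite -initial_ballE ballEmdist. Qed.

HB.instance Definition _ := PseudoMetric_isMetric.Build R (set_type A)
  sub_dist_ge0 sub_dist_positivity ball_sub_dist.

Lemma mdist_set_val (x y : A) : mdist x y = mdist (set_val x) (set_val y).
Proof. by []. Qed.

End SubspaceMetric.

(** * The action on tournaments *)

Section Tournaments.
Variables (G : topologicalGroupType) (D : choiceType) (act : G -> D -> D).
Hypotheses (act1 : forall x, act 1%g x = x)
  (actM : forall g h x, act (g * h)%g x = act g (act h x))
  (act_cst : forall g x, \forall h \near g, act h x = act g x).

Definition tournament : set {ptws D * D -> bool} :=
  [set c | forall x y, x != y -> c (y, x) = ~~ c (x, y)].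

(** Orient [x, y] towards the point selected by the choice function, whose value
    depends on the unordered pair only. *)
Lemma tournament_exists : tournament !=set0.
Proof.
exists (fun p => choose (pred2 p.1 p.2) p.1 == p.1) => x y xy /=.
have -> : choose (pred2 y x) y = choose (pred2 x y) x.
  rewrite (@eq_choose _ _ (pred2 x y)) => [|z /=]; last exact: orbC.
  by apply: choose_id; rewrite /= eqxx ?orbT.
have /orP[/eqP->|/eqP->] : pred2 x y (choose (pred2 x y) x).
  by apply: chooseP; rewrite /= eqxx.
  by rewrite eqxx (negPf xy).
by rewrite eqxx eq_sym xy.
Qed.

(** Coordinates of the cube are continuous with values in a discrete space.  This
    one fact yields both closedness of the tournaments and continuity of the
    action. *)
Lemma eval_locally_constant (c : {ptws D * D -> bool}) p :
  \forall d \near c, d p = c p.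
Proof. exact: (@proj_continuous _ (fun=> bool) p c _ (discrete_set1 _)). Qed.

Lemma tournament_compact : compact tournament.
Proof.
have Tco : compact [set: {ptws D * D -> bool}].
  have := @tychonoff (D * D)%type (fun=> bool) (fun=> setT) (fun=> bool_compact).
  by congr compact; apply/seteqP.
apply: subclosed_compact Tco _ => //.
move=> c clc x y xy.
have [d [Td [/= <- <-]]] :=
  clc _ (filterI (eval_locally_constant c (x, y))
                 (eval_locally_constant c (y, x))).
exact: Td.
Qed.

Lemma act_inj g : injective (act g).
Proof. by apply: (@can_inj _ _ _ (act g^-1%g)) => x; rewrite -actM mulVg act1. Qed.

Lemma push_mem_tournament g (c : tournament) :
  (fun p => set_val c (act g^-1%g p.1, act g^-1%g p.2)) \in tournament.
Proof.
apply/mem_set => x y xy /=; apply: (set_valP c).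
by rewrite (inj_eq (@act_inj _)).
Qed.

Definition tournament_push g (c : tournament) : tournament :=
  exist (fun d => d \in tournament) _ (push_mem_tournament g c).

Lemma tournament_pushE g c x y :
  set_val (tournament_push g c) (x, y) =
  set_val c (act g^-1%g x, act g^-1%g y).
Proof. by []. Qed.

(** For continuity at [(g, c)], each coordinate [(x, y)] is locally constant:
    near [g] the points [g^-1 x] and [g^-1 y] do not move, and near [c] the value
    at this fixed pair does not change. *)
Lemma tournament_push_action : continuous_action tournament_push.
Proof.
split=> [c|g h c|].
- apply/val_inj/funext => -[x y] /=.
  by rewrite invg1 !act1.
- apply/val_inj/funext => -[x y] /=.
  by rewrite !set_valE /= invgM !actM.
- apply: continuous_comp_initial => -[g c].
  have cval : continuous (set_val : tournament -> {ptws D * D -> bool}).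
    exact: initial_continuous.
  apply/cvg_sup => -[x y] B [_ [[A Aop <-] /= Ac] AB].
  pose z := (act g^-1%g x, act g^-1%g y).
  have near_inv t : \forall q \near (g, c), act q.1^-1%g t = act g^-1%g t.
    have ginv : (fun q : G * tournament => q.1^-1%g) @ (g, c) --> g^-1%g.
      apply: (cvg_comp _ _ (@cvg_fst _ _ (nbhs g) (nbhs c) _)).
      exact: invg_continuous.
    exact: ginv (act_cst g^-1%g t).
  have near_val : \forall q \near (g, c), set_val q.2 z = set_val c z.
    have nc := cval c _ (eval_locally_constant (set_val c) z).
    exact: (@cvg_snd _ _ (nbhs g) (nbhs c) _ _ nc).
  have near_push : \forall q \near (g, c),
      set_val (tournament_push q.1 q.2) (x, y) =
      set_val (tournament_push g c) (x, y).
    near=> q; rewrite !tournament_pushE.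
    have -> : act q.1^-1%g x = act g^-1%g x by near: q; exact: near_inv.
    have -> : act q.1^-1%g y = act g^-1%g y by near: q; exact: near_inv.
    by near: q; exact: near_val.
  by apply: filterS near_push => q qE; apply: AB; rewrite /preimage /= qE.
Unshelve. all: by end_near. Qed.

(** If [g] swaps [x] and [y], an invariant tournament orients [(x, y)] and
    [(y, x)] alike, against the definition. *)
Lemma swap_no_fixed_point g x y :
  x != y -> act g x = y -> act g y = x -> ~ fixed_point_on_compacta G.
Proof.
move=> xy gx gy fix_compacta.
have [c cT] := tournament_exists.
have tournament_hausdorff : hausdorff_space tournament.
  apply: hausdorff_set_type.
  by apply: (@hausdorff_product _ (fun=> bool)) => p; exact: discrete_hausdorff.
have [d fixd] := fix_compacta tournament (ex_intro _ (exist _ c (mem_set cT)) I)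
  (compact_set_type tournament_compact) tournament_hausdorff
  _ tournament_push_action.
have := congr1 (fun e : tournament => set_val e (y, x)) (fixd g).
have dswap : set_val d (y, x) = ~~ set_val d (x, y) by exact: (set_valP d).
have gVy : act g^-1%g y = x by rewrite -gx -actM mulVg act1.
have gVx : act g^-1%g x = y by rewrite -gy -actM mulVg act1.
by rewrite tournament_pushE gVy gVx dswap; case: (set_val d (x, y)).
Qed.

End Tournaments.

(** * Ultrahomogeneity of the Urysohn space *)

Section Homogeneity.
Variable R : realType.

(** A finite partial isometry is encoded by its graph, so that going back and
    going forth are exchanged by swapping the components of the pairs. *)
Definition partial_isometry (M N : metricType R) (s : seq (M * N)) :=
  forall p q, p \in s -> q \in s -> mdist p.1 q.1 = mdist p.2 q.2.

Variables (eps : R) (U : metricType R).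

(** A form of the extension property free of auxiliary metric spaces and of total
    functions: the one-point extension is realized inside a given space [M], by
    the points [b :: unzip1 s].  The lattice condition bears on these points
    rather than on [M], so that [M] may be the real line. *)
Lemma one_point_extend (M : metricType R) (s : seq (M * U)) (b : M) :
  one_point_extension_property eps U -> partial_isometry s ->
  (forall x y, x \in b :: unzip1 s -> y \in b :: unzip1 s ->
     exists k : int, mdist x y = eps *~ k) ->
  exists y, partial_isometry ((b, y) :: s).
Proof.
move=> extU s_iso s_lat.
pose X : set M := [set x | x \in b :: unzip1 s].
pose h (y : U) : M := (nth (b, y) s (index y (unzip2 s))).1.
(* Off [unzip2 s] the index is out of range and the default value [b] is
   returned, so [h] maps all of [U] into [X]. *)
have hX y : X (h y).
  rewrite /X /h /= inE; have [ys|sy] := ltnP (index y (unzip2 s)) (size s).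
    by rewrite (map_f fst) ?orbT// mem_nth.
  by rewrite nth_default//= eqxx.
have hE p : p \in s -> h p.2 = p.1.
  move=> ps; have p2s : (index p.2 (unzip2 s) < size s)%N.
    by rewrite -(size_map snd) index_mem; exact: map_f.
  apply: mdist_positivity; rewrite s_iso ?mem_nth//.
  rewrite -(nth_map _ p.2)// nth_index ?mdistxx//; exact: map_f.
have bX : X b by exact: mem_head.
pose i (y : U) : X := exist _ (h y) (mem_set (hX y)).
pose a : X := exist _ b (mem_set bX).
have [||||k k_iso ki] := extU [set` unzip2 s] X i a.
- exact: finite_seq.
- by move=> x y; exact: s_lat (set_valP x) (set_valP y).
- move=> _ _ /mapP[p ps ->] /mapP[q qs ->].
  by rewrite mdist_set_val /= !set_valE /= !hE// s_iso.
- apply/seteqP; split=> // -[z zX] _.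
  have : z \in b :: unzip1 s by exact: (set_mem zX).
  rewrite inE => /orP[/eqP zb|/mapP[p ps zp]].
    by left; apply: val_inj; rewrite /= zb.
  right; exists p.2; first exact: map_f.
  by apply: val_inj; rewrite /= hE.
have kb p : p \in s -> mdist (k a) p.2 = mdist b p.1.
  move=> ps; rewrite -[p.2]ki; last exact: map_f.
  by rewrite k_iso// mdist_set_val /= !set_valE /= hE.
exists (k a) => p q; rewrite !inE => /orP[/eqP->|ps] /orP[/eqP->|qs] /=.
- by rewrite !mdistxx.
- by rewrite kb.
- by rewrite metric_sym [RHS]metric_sym kb.
- exact: s_iso.
Qed.

Hypotheses (eps0 : 0 < eps) (urysohnU : lattice_urysohn eps U).

(** Realize the subspace [{0, eps}] of the real line, one point at a time. *)
Lemma urysohn_two_points : exists x y : U, mdist x y = eps.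
Proof.
have [_ _ _ extU] := urysohnU.
have [|x y|x _] := @one_point_extend R^o [::] 0 extU.
- by [].
- by rewrite !inE => /eqP-> /eqP->; exists 0; rewrite mdistxx mulr0z.
have dE (u v : R^o) : mdist u v = `|v - u| by [].
have [||y xy] := @one_point_extend R^o [:: (0, x)] eps extU.
- by move=> p q; rewrite !inE => /eqP-> /eqP->; rewrite !mdistxx.
- move=> u v; rewrite !inE => /orP[] /eqP-> /orP[] /eqP->.
  + by exists 0; rewrite mdistxx mulr0z.
  + by exists 1; rewrite dE sub0r normrN gtr0_norm// mulr1z.
  + by exists 1; rewrite dE subr0 gtr0_norm// mulr1z.
  + by exists 0; rewrite mdistxx mulr0z.
exists x, y; have /= := xy (0, x) (eps, y).
by rewrite !inE !eqxx orbT => <-//; rewrite dE subr0 gtr0_norm.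
Qed.

Lemma lattice_dist_eq (x y : U) : mdist x y < eps -> x = y.
Proof.
have [_ _ latU _] := urysohnU; have [k dk] := latU x y.
have := mdist_ge0 x y; rewrite dk.
rewrite -mulrzr pmulr_rge0// -[ltRHS]mulr1 ltr_pM2l// ler0z ltrz1 => k0 k1.
have k00 : k = 0 by case: k k0 k1 {dk} => [[]|].
by apply: mdist_positivity; rewrite dk k00 mulr0z.
Qed.

(** A dense set meets every ball of radius [eps], and these are singletons. *)
Lemma urysohn_countable : countable [set: U].
Proof.
have [_ [D Dcount Ddense] _ _] := urysohnU.
suff -> : [set: U] = D by [].
apply/esym/seteqP; split=> // x _.
have ball_open : open (interior (ball x eps)) by exact: open_interior.
have [|y [/interior_subset + Dy]] := Ddense _ _ ball_open.
  by exists x; apply: nbhsx_ballx.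
by rewrite ballEmdist /= => /lattice_dist_eq ->.
Qed.

(** Here the one-point extension to realize is a subspace of [U] itself. *)
Lemma extend_forth (s : seq (U * U)) x : partial_isometry s ->
  exists y, partial_isometry ((x, y) :: s).
Proof.
have [_ _ latU extU] := urysohnU.
by move=> s_iso; apply: one_point_extend => // *; exact: latU.
Qed.

Lemma extend_back (s : seq (U * U)) y : partial_isometry s ->
  exists x, partial_isometry ((x, y) :: s).
Proof.
move=> s_iso.
have [|x xs] := @extend_forth [seq (p.2, p.1) | p <- s] y.
  by move=> _ _ /mapP[p ps ->] /mapP[q qs ->] /=; rewrite s_iso.
exists x => p q ps qs.
have mem_swap r : r \in (x, y) :: s ->
    (r.2, r.1) \in (y, x) :: [seq (p.2, p.1) | p <- s].
  by rewrite !inE => /orP[/eqP->|/(map_f (fun p => (p.2, p.1)))->];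
    rewrite ?eqxx ?orbT.
by have := xs _ _ (mem_swap p ps) (mem_swap q qs).
Qed.

(** Back and forth along an enumeration [e] of the space: stage [n] puts [e n]
    both in the domain and in the range, and the union of the graphs is an
    isometry onto. *)
Lemma ultrahomogeneous (s : seq (U * U)) : partial_isometry s ->
  exists g : self_isometry U, forall p, p \in s -> g p.1 = p.2.
Proof.
move=> s_iso.
have [x0 _] := urysohn_two_points.
have [code code_inj] := countable_injP _ urysohn_countable.
pose e n := xget x0 [set x | code x = n].
have eE x : e (code x) = x.
  rewrite /e; case: xgetP => [y _ /=|/(_ x) []//].
  by move=> /code_inj; apply; rewrite inE.
have step (nt : nat * seq (U * U)) : exists t', partial_isometry nt.2 ->
    [/\ partial_isometry t', {subset nt.2 <= t'},
        exists y, (e nt.1, y) \in t' & exists x, (x, e nt.1) \in t'].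
  case: nt => n t /=; have [t_iso|] := pselect (partial_isometry t); last first.
    by exists [::].
  have [y ty_iso] := extend_forth (e n) t_iso.
  have [x txy_iso] := extend_back (e n) ty_iso.
  exists [:: (x, e n), (e n, y) & t]; split=> //.
  - by move=> p pt; rewrite !inE pt !orbT.
  - by exists y; rewrite !inE eqxx orbT.
  - by exists x; rewrite !inE eqxx.
have [F FP] := choice step.
pose t n := iteri n (fun m u => F (m, u)) s.
have t_iso n : partial_isometry (t n).
  by elim: n => [|n IH] //; have [] := FP (n, t n) IH.
have tS n : {subset t n <= t n.+1} by have [] := FP (n, t n) (t_iso n).
have t_mono m n : (m <= n)%N -> {subset t m <= t n}.
  move=> mn; rewrite -(subnKC mn); elim: (n - m)%N => [|k IH].
    by rewrite addn0.
  by move=> p /IH; rewrite addnS; exact: tS.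
have t_union m n p q : p \in t m -> q \in t n -> mdist p.1 q.1 = mdist p.2 q.2.
  move=> pm qn; apply: (t_iso (maxn m n)).
    exact: t_mono (leq_maxl _ _) _ pm.
  exact: t_mono (leq_maxr _ _) _ qn.
have t_dom x : exists y, exists n, (x, y) \in t n.
  have [_ _ [y xy] _] := FP (code x, t (code x)) (t_iso _).
  by exists y, (code x).+1; rewrite eE in xy.
have t_cod y : exists x, exists n, (x, y) \in t n.
  have [_ _ _ [x xy]] := FP (code y, t (code y)) (t_iso _).
  by exists x, (code y).+1; rewrite eE in xy.
have [g gt] := choice t_dom.
have g_eq n x y : (x, y) \in t n -> g x = y.
  have [m xm] := gt x => xyn; apply: mdist_positivity.
  by rewrite -(t_union _ _ _ _ xm xyn) mdistxx.
have g_iso x y : mdist (g x) (g y) = mdist x y.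
  have [m xm] := gt x; have [n yn] := gt y.
  by rewrite -(t_union _ _ _ _ xm yn).
have g_surj y : exists x, g x = y.
  by have [x [n xy]] := t_cod y; exists x; exact: g_eq xy.
exists (Isometry g_iso g_surj) => -[x y] xy /=.
exact: (g_eq 0%N).
Qed.

End Homogeneity.

(** * The isometry group *)

Theorem theorem6p9 (R : realType) (eps : R) (U : metricType R) :
  0 < eps -> lattice_urysohn eps U -> ~ fixed_point_on_compacta (self_isometry U).
Proof.
move=> eps0 urysohnU.
have [x [y xy]] := urysohn_two_points eps0 urysohnU.
have [|g gP] := @ultrahomogeneous _ _ _ eps0 urysohnU [:: (x, y); (y, x)].
  by move=> p q; rewrite !inE => /orP[] /eqP-> /orP[] /eqP->;
    rewrite /= ?mdistxx// metric_sym.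
have gx : g x = y by apply: (gP (x, y)); rewrite !inE eqxx.
have gy : g y = x by apply: (gP (y, x)); rewrite !inE eqxx orbT.
apply: (@swap_no_fixed_point (self_isometry U) U (fun f z => f z) _ _ _ g x y) => //.
- move=> f z.
  have fz : (fun h : self_isometry U => h z) @ f --> f z.
    by apply: (cvg_isometryP (nbhs_filter f) id f).1; exact: cvg_id.
  near=> h; apply: (lattice_dist_eq eps0 urysohnU); rewrite metric_sym.
  by near: h; exact: cvgr_dist_lt fz _ eps0.
- by rewrite -mdist_gt0 xy.
Unshelve. all: by end_near. Qed.
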